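(* Let $F$ be a field. For every $G\in\mathbf{Grp}'_F$ and $A\in\mathbf{GrpAlg}'_F$ there exists a bijection $$\theta_{G,A}\colon\mathbf{GrpAlg}'_F(FG,A)\to\mathbf{Grp}'_F(G,U(A))$$ which is natural in $A$ and $G$. Furthermore, $FU(-)=1_{\mathbf{GrpAlg}'_F}$ and $U(F-)=1_{\mathbf{Grp}'_F}$, i.e. the categories $\mathbf{Grp}'_F$ and $\mathbf{GrpAlg}'_F$ are isomorphic.
   Context: $\mathcal A(a,b)$ denotes the set of morphisms $a\to b$ in a category $\mathcal A$, and $1_{\mathcal A}$ denotes the identity functor of $\mathcal A$. For a group $G$, $FG$ denotes the group algebra over $F$ with standard basis $(u_g)_{g\in G}$, endowed with its standard $G$-grading $FG^{(g)}=Fu_g$. An algebra homomorphism $\varphi\colon FG_1\to FG_2$ is graded if for every $g\in G_1$ there exists $h\in G_2$ with $\varphi(FG_1^{(g)})\subseteq FG_2^{(h)}$. $\mathbf{Grp}'_F$ is the category whose objects are the groups $G$ that do not have non-trivial one-dimensional representations over $F$ (i.e. every group homomorphism $G\to F^\times$ is trivial; in other words $H^1(G,F^\times)=0$) and whose morphisms are all group homomorphisms. $\mathbf{GrpAlg}'_F$ is the category whose objects are the group algebras $FG$ of groups $G$ from $\mathbf{Grp}'_F$ with the standard grading (each object remembering its group $G$) and whose morphisms are all non-zero graded homomorphisms. The functor $U\colon\mathbf{GrpAlg}'_F\to\mathbf{Grp}'_F$ is defined by $U(FG)=G$ and, for $\varphi\colon FG_1\to FG_2$, by $\varphi(FG_1^{(g)})\subseteq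 FG_2^{(U(\varphi)(g))}$ for $g\in G_1$. The functor $F-\colon\mathbf{Grp}'_F\to\mathbf{GrpAlg}'_F$ associates to each group its group algebra over $F$ (and to a group homomorphism its linear extension); $FU(-)$ is the composition of $U$ followed by $F-$. *)

(* Defs.v *)
From HB Require Import structures.
From mathcomp Require Import all_boot all_algebra finmap.
From mathcomp Require Import boolp.
From mathcomp.multinomials Require Import monalg.

Set Implicit Arguments.
Unset Strict Implicit.
Unset Printing Implicit Defensive.

Import GRing.Theory.
Local Open Scope ring_scope.

Record category := Category {
  cat_ob :> Type;
  cat_hom : cat_ob -> cat_ob -> Type;
  cat_id : forall a, cat_hom a a;
  cat_comp : forall a b c, cat_hom b c -> cat_hom a b -> cat_hom a c;
  cat_compA : forall a b c d
      (h : cat_hom c d) (g : cat_hom b c) (f : cat_hom a b),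
    cat_comp h (cat_comp g f) = cat_comp (cat_comp h g) f;
  cat_comp1l : forall a b (f : cat_hom a b), cat_comp (cat_id b) f = f;
  cat_comp1r : forall a b (f : cat_hom a b), cat_comp f (cat_id a) = f
}.

Arguments cat_hom {c} a b : rename.
Arguments cat_id {c} a : rename.
Arguments cat_comp {c a b c0} g f : rename.

Record functor (C D : category) := Functor {
  functor_ob :> C -> D;
  functor_map : forall a b : C,
    cat_hom a b -> cat_hom (functor_ob a) (functor_ob b);
  functor_map1 : forall a : C, functor_map (cat_id a) = cat_id (functor_ob a);
  functor_mapM : forall (a b c : C) (g : cat_hom b c) (f : cat_hom a b),
    functor_map (cat_comp g f) = cat_comp (functor_map g) (functor_map f)
}.

Arguments functor_map {C D} f {a b} _ : rename.

Section FunctorOps.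
Variables C D E : category.

Definition id_functor : functor C C :=
  @Functor C C (fun a => a) (fun _ _ f => f) (fun=> erefl)
    (fun _ _ _ _ _ => erefl).

Variables (T : functor D E) (S : functor C D).

Fact comp_fmap1 (a : C) :
  functor_map T (functor_map S (cat_id a)) = cat_id (T (S a)).
Proof. by rewrite !functor_map1. Qed.

Fact comp_fmapM (a b c : C) (g : cat_hom b c) (f : cat_hom a b) :
  functor_map T (functor_map S (cat_comp g f)) =
  cat_comp (functor_map T (functor_map S g)) (functor_map T (functor_map S f)).
Proof. by rewrite !functor_mapM. Qed.

Definition comp_functor : functor C E :=
  @Functor C E (fun a => T (S a)) (fun _ _ f => functor_map T (functor_map S f))
    comp_fmap1 comp_fmapM.

End FunctorOps.

Definition isomorphic_categories (C D : category) : Prop :=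
  exists (S : functor C D) (T : functor D C),
    comp_functor S T = id_functor D /\ comp_functor T S = id_functor C.

(* [{malg F[G]}] is the free F-module on G; its library product asks for a
   [monomType], i.e. a monoid without non-trivial units, hence the product
   is defined here. *)
Definition group_algebra (F : fieldType) (G : groupType) : Type := {malg F[G]}.

Section GroupAlgebra.
Variables (F : fieldType) (G : groupType).
Local Notation FG := (group_algebra F G).

HB.instance Definition _ := GRing.Lmodule.on FG.

Definition gbasis (g : G) : FG := << 1 *g g >>.

Definition gone : FG := gbasis 1%g.

Definition gmul (x y : FG) : FG :=
  \sum_(g <- msupp x) \sum_(h <- msupp y) (x@_g * y@_h) *: gbasis (g * h)%g.

Lemma scale_gbasis a g : a *: gbasis g = << a *g g >> :> {malg F[G]}.
Proof. by apply/malgP => k; rewrite mcoeffZ !mcoeffU mulrnAr mulr1. Qed.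

Lemma galgE (x : FG) : x = \sum_(g <- msupp x) x@_g *: gbasis g.
Proof.
by rewrite {1}[x]monalgE; apply: eq_bigr => g _; rewrite scale_gbasis.
Qed.

Lemma gmulw (d1 d2 : {fset G}) (x y : FG) :
  (msupp x `<=` d1)%fset -> (msupp y `<=` d2)%fset ->
  gmul x y = \sum_(g <- d1) \sum_(h <- d2) (x@_g * y@_h) *: gbasis (g * h)%g.
Proof.
move=> le1 le2; rewrite /gmul (big_fset_incl _ le1) /=.
  apply/eq_bigr=> k1 _; apply/big_fset_incl => // k _ /mcoeff_outdom ->.
  by rewrite mulr0 scale0r.
move=> k _ /mcoeff_outdom xk.
by rewrite big1 => // k' _; rewrite xk mul0r scale0r.
Qed.

Lemma gmul_basis a b g h :
  gmul (a *: gbasis g) (b *: gbasis h) = (a * b) *: gbasis (g * h)%g.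
Proof.
have le c k : (msupp (c *: gbasis k) `<=` [fset k])%fset.
  exact: fsubset_trans (msuppZ_le _ _) msuppU_le.
rewrite (gmulw (le a g) (le b h)) !big_seq_fset1.
by rewrite !mcoeffZ !mcoeffUU !mulr1.
Qed.

Lemma gmulDl : left_distributive gmul +%R.
Proof.
move=> x y z.
rewrite (gmulw (msuppD_le x y) (fsubset_refl _)).
rewrite (gmulw (fsubsetUl (msupp x) (msupp y)) (fsubset_refl (msupp z))).
rewrite (gmulw (fsubsetUr (msupp x) (msupp y)) (fsubset_refl (msupp z))).
rewrite -big_split /=; apply/eq_bigr=> k1 _.
rewrite -big_split /=; apply/eq_bigr=> k2 _.
by rewrite mcoeffD mulrDl scalerDl.
Qed.

Lemma gmulDr : right_distributive gmul +%R.
Proof.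
move=> z x y.
rewrite (gmulw (fsubset_refl _) (msuppD_le x y)).
rewrite (gmulw (fsubset_refl (msupp z)) (fsubsetUl (msupp x) (msupp y))).
rewrite (gmulw (fsubset_refl (msupp z)) (fsubsetUr (msupp x) (msupp y))).
rewrite -big_split /=; apply/eq_bigr=> k1 _.
rewrite -big_split /=; apply/eq_bigr=> k2 _.
by rewrite mcoeffD mulrDr scalerDl.
Qed.

Lemma gmul0 : left_zero 0 gmul.
Proof. by move=> x; rewrite /gmul msupp0 big_seq_fset0. Qed.

Lemma gmulr0 : right_zero 0 gmul.
Proof.
by move=> x; rewrite /gmul big1 // => g _; rewrite msupp0 big_seq_fset0.
Qed.

Lemma gmul_suml I (r : seq I) (f : I -> FG) y :
  gmul (\sum_(i <- r) f i) y = \sum_(i <- r) gmul (f i) y.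
Proof. exact: (big_morph (gmul^~ y) (fun a b => gmulDl a b y) (gmul0 y)). Qed.

Lemma gmul_sumr I (r : seq I) (f : I -> FG) y :
  gmul y (\sum_(i <- r) f i) = \sum_(i <- r) gmul y (f i).
Proof. exact: (big_morph (gmul y) (gmulDr y) (gmulr0 y)). Qed.

Lemma gmulA : associative gmul.
Proof.
move: gmul gmul_suml gmul_sumr gmul_basis => m suml sumr m_basis x y z.
rewrite (galgE x) !suml; apply: eq_bigr => g _.
rewrite (galgE y) (suml _ _ _ z) !sumr (suml _ _ _ z); apply: eq_bigr => h _.
rewrite (galgE z) !(sumr _ (msupp z)); apply: eq_bigr => k _.
by rewrite !m_basis mulrA mulgA.
Qed.

Lemma gmul1 : left_id gone gmul.
Proof.
move=> x; rewrite [in LHS](galgE x) gmul_sumr [RHS]galgE.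
by apply: eq_bigr => g _; rewrite -[gone]scale1r gmul_basis mul1r mul1g.
Qed.

Lemma gmulr1 : right_id gone gmul.
Proof.
move=> x; rewrite [in LHS](galgE x) gmul_suml [RHS]galgE.
by apply: eq_bigr => g _; rewrite -[gone]scale1r gmul_basis mulr1 mulg1.
Qed.

Lemma gbasis_neq0 g : gbasis g != 0.
Proof.
by apply/eqP/malgP => /(_ g)/eqP; rewrite mcoeffUU mcoeff0 oner_eq0.
Qed.

HB.instance Definition _ := GRing.Zmodule_isNzRing.Build FG
  gmulA gmul1 gmulr1 gmulDl gmulDr (gbasis_neq0 1%g).

Fact galg_scaleAl (a : F) (x y : FG) : a *: (x * y) = (a *: x) * y.
Proof.
rewrite (galgE x) (galgE y) scaler_sumr !mulr_suml scaler_sumr.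
apply: eq_bigr => g _; rewrite !mulr_sumr scaler_sumr.
apply: eq_bigr => h _; rewrite scalerA.
by rewrite /GRing.mul /= !gmul_basis scalerA mulrA.
Qed.

HB.instance Definition _ := GRing.Lmodule_isLalgebra.Build F FG galg_scaleAl.

Fact galg_scaleAr (a : F) (x y : FG) : a *: (x * y) = x * (a *: y).
Proof.
rewrite (galgE x) (galgE y) scaler_sumr !mulr_suml scaler_sumr.
apply: eq_bigr => g _; rewrite !mulr_sumr scaler_sumr.
apply: eq_bigr => h _; rewrite scalerA.
by rewrite /GRing.mul /= !gmul_basis scalerA mulrCA.
Qed.

HB.instance Definition _ := GRing.Lalgebra_isAlgebra.Build F FG galg_scaleAr.

Lemma gbasisMZ a b g h :
  (a *: gbasis g) * (b *: gbasis h) = (a * b) *: gbasis (g * h)%g.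
Proof. exact: gmul_basis. Qed.

Lemma gbasisM g h : gbasis g * gbasis h = gbasis (g * h)%g.
Proof.
by have := gbasisMZ 1 1 g h; rewrite mulr1 !scale1r.
Qed.

(* The homogeneous component F u_g of the standard G-grading. *)
Definition component (g : G) (x : FG) : Prop := exists a : F, x = a *: gbasis g.

Lemma gbasis_component g : component g (gbasis g).
Proof. by exists 1; rewrite scale1r. Qed.

Lemma component_inj g h x : x != 0 -> component g x -> component h x -> g = h.
Proof.
move=> x0 [a xE] [b xE']; apply/eqP; apply: contraNT x0 => gh.
have /malgP/(_ g) : a *: gbasis g = b *: gbasis h :> {malg F[G]}.
  by rewrite -xE -xE'.
rewrite !mcoeffZ !mcoeffU eqxx [h == g]eq_sym (negbTE gh) mulr1 mulr0 => a0.
by rewrite xE a0 scale0r.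
Qed.

End GroupAlgebra.

Arguments gbasis {F G} g.
Arguments component {F G} g x.

Definition is_graded (F : fieldType) (G H : groupType)
    (phi : group_algebra F G -> group_algebra F H) : Prop :=
  forall g : G, exists h : H,
    forall x, component g x -> component h (phi x).

(* Algebra homomorphisms are not required to be unital; for graded ones this
   follows from being non-zero, see [graded_hom1]. *)
Record graded_hom (F : fieldType) (G H : groupType) := GradedHom {
  graded_fun :> {linear group_algebra F G -> group_algebra F H};
  graded_homM : {morph graded_fun : x y / x * y};
  graded_homP : is_graded graded_fun;
  graded_hom_neq0 : exists x, graded_fun x != 0
}.

Section GradedHom.
Variable F : fieldType.

Lemma graded_hom_ext (G H : groupType) (phi psi : graded_hom F G H) :
  (forall x, phi x = psi x) -> phi = psi.
Proof.
case: phi psi => [f fM fg fn] [f' fM' fg' fn'] /= ff'.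
have {}ff' : f = f'.
  case: f f' ff' {fM fg fn fM' fg' fn'} => [f cf] [f' cf'] /= /funext ff'.
  case: f' / ff' cf' => cf'; congr GRing.Linear.Pack.
  case: cf cf' => [[a0] [b0]] [[a1] [b1]].
  by rewrite (Prop_irrelevance a0 a1) (Prop_irrelevance b0 b1).
case: f' / ff' fM' fg' fn' => fM' fg' fn'.
by congr GradedHom; apply: Prop_irrelevance.
Qed.

Section Theory.
Variables (G H : groupType) (phi : graded_hom F G H).

Lemma graded_hom_basis_neq0 g : phi (gbasis g) != 0.
Proof.
case: (graded_hom_neq0 phi) => x; apply: contraNN => /eqP phig.
rewrite (galgE x) linear_sum big1 ?eqxx //= => h _.
rewrite linearZ /= -[h](mulgVK g) -gbasisM graded_homM phig.
by rewrite mulr0 scaler0.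
Qed.

Definition graded_idx (g : G) : H := sval (cid (graded_homP phi g)).

Lemma graded_idxP g x : component g x -> component (graded_idx g) (phi x).
Proof. exact: (svalP (cid (graded_homP phi g))). Qed.

Lemma graded_idx_uniq g h :
  (forall x, component g x -> component h (phi x)) -> graded_idx g = h.
Proof.
move=> gh; apply: component_inj (graded_hom_basis_neq0 g) _ _.
  exact: graded_idxP (gbasis_component _ _).
exact: gh (gbasis_component _ _).
Qed.

Lemma graded_idxM g h : graded_idx (g * h)%g = (graded_idx g * graded_idx h)%g.
Proof.
apply: graded_idx_uniq => _ [a ->].
have [b gE] := graded_idxP (gbasis_component F g).
have [c hE] := graded_idxP (gbasis_component F h).
rewrite -gbasisM linearZ graded_homM gE hE /=; exists (a * (b * c)).
by rewrite -scalerAl -scalerAr gbasisM !scalerA mulrA.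
Qed.

Lemma graded_idx1 : graded_idx 1%g = 1%g.
Proof. by apply: (mulgI (graded_idx 1%g)); rewrite -graded_idxM !mulg1. Qed.

Lemma graded_hom1 : phi 1 = 1.
Proof.
have [b E] := graded_idxP (gbasis_component F (1%g : G)).
have := graded_homM phi 1 1; rewrite mulr1.
have -> : phi 1 = b *: 1 by rewrite -[LHS]/(phi (gbasis 1%g)) E graded_idx1.
have b0 : b != 0.
  by apply: contraNneq (graded_hom_basis_neq0 1%g) => b0; rewrite E b0 scale0r.
rewrite -scalerAl mul1r => /(congr1 (fun z => b^-1 *: z)).
by rewrite !scalerA mulVf // mul1r scale1r => <-.
Qed.

End Theory.

Definition graded_id (G : groupType) : graded_hom F G G.
Proof.
apply: (@GradedHom F G G idfun) => //.
- by move=> g; exists g.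
- by exists 1; exact: oner_neq0.
Defined.

Definition graded_comp (G H K : groupType)
  (psi : graded_hom F H K) (phi : graded_hom F G H) : graded_hom F G K.
Proof.
apply: (@GradedHom F G K (psi \o phi)).
- by move=> x y /=; rewrite !graded_homM.
- move=> g; exists (graded_idx psi (graded_idx phi g)) => x gx.
  exact/graded_idxP/graded_idxP.
- by exists 1; rewrite /= !graded_hom1 oner_neq0.
Defined.

End GradedHom.

Section UnitGroup.
Variable F : fieldType.

Definition unit_group : Type := {x : F | x \is a GRing.unit}.
HB.instance Definition _ := Choice.on unit_group.

Implicit Types x y z : unit_group.

Definition ug_one : unit_group := exist _ 1 (unitr1 F).
Definition ug_inv x : unit_group :=
  exist _ (val x)^-1 (etrans (unitrV _) (valP x)).
Definition ug_mul x y : unit_group :=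
  exist _ (val x * val y) (etrans (unitrMr _ (valP x)) (valP y)).

Fact ug_mulA : associative ug_mul.
Proof. by move=> x y z; apply: val_inj; rewrite /= mulrA. Qed.
Fact ug_mul1 : left_id ug_one ug_mul.
Proof. by move=> x; apply: val_inj; rewrite /= mul1r. Qed.
Fact ug_mulr1 : right_id ug_one ug_mul.
Proof. by move=> x; apply: val_inj; rewrite /= mulr1. Qed.
Fact ug_mulV : left_inverse ug_one ug_inv ug_mul.
Proof. by move=> x; apply: val_inj; rewrite /= mulVr ?(valP x). Qed.
Fact ug_mulrV : right_inverse ug_one ug_inv ug_mul.
Proof. by move=> x; apply: val_inj; rewrite /= mulrV ?(valP x). Qed.

HB.instance Definition _ := isGroup.Build unit_group
  ug_mulA ug_mul1 ug_mulr1 ug_mulV ug_mulrV.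

End UnitGroup.

Notation group_hom G H := (UMagmaMorphism.type G H).

Lemma group_hom_ext (G H : groupType) (f f' : group_hom G H) :
  (forall x, f x = f' x) -> f = f'.
Proof.
case: f f' => [f cf] [f' cf'] /= /funext ff'.
case: f' / ff' cf' => cf'; congr UMagmaMorphism.Pack.
case: cf cf' => [[a0] [b0]] [[a1] [b1]].
by rewrite (Prop_irrelevance a0 a1) (Prop_irrelevance b0 b1).
Qed.

Record grp' (F : fieldType) := Grp' {
  grp_sort :> groupType;
  grp_no_char : forall (chi : group_hom grp_sort (unit_group F)) g,
    chi g = 1%g
}.

Section GroupHom.

Definition group_comp (G H K : groupType) (g : group_hom H K)
  (f : group_hom G H) : group_hom G K := g \o f.

Variable F : fieldType.

Definition graded_group_hom (G H : groupType) (phi : graded_hom F G H) :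
  group_hom G H :=
  HB.pack (graded_idx phi)
    (isUMagmaMorphism.Build G H (graded_idx phi)
       (graded_idx1 phi, graded_idxM phi)).

Section LinearExtension.
Variables (G H : groupType) (f : group_hom G H).

Definition lin_ext_fun (x : group_algebra F G) : group_algebra F H :=
  \sum_(g <- msupp x) x@_g *: gbasis (f g).

Lemma lin_ext_funw (d : {fset G}) x : (msupp x `<=` d)%fset ->
  lin_ext_fun x = \sum_(g <- d) x@_g *: gbasis (f g).
Proof.
move=> le; apply: big_fset_incl => // g _ /mcoeff_outdom ->.
by rewrite scale0r.
Qed.

Fact lin_ext_is_linear : linear lin_ext_fun.
Proof.
move=> a x y.
have le : (msupp (a *: x + y) `<=` msupp x `|` msupp y)%fset.
  exact: fsubset_trans (msuppD_le _ _) (fsetSU _ (msuppZ_le _ _)).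
rewrite (lin_ext_funw le) (lin_ext_funw (fsubsetUl (msupp x) (msupp y))).
rewrite (lin_ext_funw (fsubsetUr (msupp x) (msupp y))) scaler_sumr -big_split.
by apply: eq_bigr => g _; rewrite mcoeffD mcoeffZ scalerDl scalerA.
Qed.

HB.instance Definition _ := GRing.isLinear.Build F (group_algebra F G)
  (group_algebra F H) _ lin_ext_fun lin_ext_is_linear.

Lemma lin_ext_basis g : lin_ext_fun (gbasis g) = gbasis (f g).
Proof.
by rewrite (lin_ext_funw msuppU_le) big_seq_fset1 mcoeffUU scale1r.
Qed.

Fact lin_extM : {morph lin_ext_fun : x y / x * y}.
Proof.
move=> x y; rewrite (galgE x) (galgE y) mulr_suml !linear_sum mulr_suml.
apply: eq_bigr => g _; rewrite !mulr_sumr linear_sum; apply: eq_bigr => h _.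
rewrite -scalerAl -scalerAr gbasisM !linearZ /= !lin_ext_basis.
by rewrite -scalerAl -scalerAr gbasisM gmulfM.
Qed.

Fact lin_ext_graded : is_graded lin_ext_fun.
Proof.
move=> g; exists (f g) => _ [a ->]; exists a.
by rewrite linearZ /= lin_ext_basis.
Qed.

Fact lin_ext_neq0 : exists x, lin_ext_fun x != 0.
Proof. by exists (gbasis 1%g); rewrite lin_ext_basis gbasis_neq0. Qed.

Definition lin_ext : graded_hom F G H :=
  @GradedHom F G H lin_ext_fun lin_extM lin_ext_graded lin_ext_neq0.

End LinearExtension.

Lemma graded_hom_eq_basis (G H : groupType) (phi psi : graded_hom F G H) :
  (forall g, phi (gbasis g) = psi (gbasis g)) -> phi = psi.
Proof.
move=> E; apply: graded_hom_ext => x; rewrite (galgE x) !linear_sum.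
by apply: eq_bigr => g _; rewrite !linearZ /= E.
Qed.

End GroupHom.

Section Categories.
Variable F : fieldType.

Definition Grp'_cat : category.
Proof.
refine (@Category (grp' F) (fun G H => group_hom G H)
  (fun G => idfun : group_hom G G) (fun G H K => @group_comp G H K) _ _ _);
by move=> *; apply: group_hom_ext.
Defined.

(* An object FG remembers G, and is given by it. Primitive projections give
   eta, so that FU(A) = A holds by conversion on objects. *)
#[local] Set Primitive Projections.
Record grp_alg' := GrpAlg' { base_grp : grp' F }.
#[local] Unset Primitive Projections.

Definition GrpAlg'_cat : category.
Proof.
refine (@Category grp_alg'
  (fun A B => graded_hom F (base_grp A) (base_grp B))
  (fun A => graded_id F (base_grp A))
  (fun A B C => @graded_comp F (base_grp A) (base_grp B) (base_grp C)) _ _ _);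
by move=> *; apply: graded_hom_ext.
Defined.

Fact U_fmap1 (A : GrpAlg'_cat) :
  graded_group_hom (cat_id A) = @cat_id Grp'_cat (base_grp A).
Proof. by apply: group_hom_ext => g; apply: graded_idx_uniq. Qed.

Fact U_fmapM (A B C : GrpAlg'_cat) (psi : cat_hom B C) (phi : cat_hom A B) :
  graded_group_hom (cat_comp psi phi) =
  @cat_comp Grp'_cat _ _ _ (graded_group_hom psi) (graded_group_hom phi).
Proof.
apply: group_hom_ext => g; apply: graded_idx_uniq => x gx.
exact/graded_idxP/graded_idxP.
Qed.

Definition U_functor : functor GrpAlg'_cat Grp'_cat :=
  @Functor GrpAlg'_cat Grp'_cat (@base_grp)
    (fun A B phi => graded_group_hom phi) U_fmap1 U_fmapM.

Fact galg_fmap1 (G : Grp'_cat) :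
  lin_ext F (cat_id G) = @cat_id GrpAlg'_cat (GrpAlg' G).
Proof. by apply: graded_hom_eq_basis => g; exact: lin_ext_basis. Qed.

Fact galg_fmapM (G H K : Grp'_cat) (g : cat_hom H K) (f : cat_hom G H) :
  lin_ext F (cat_comp g f) =
  @cat_comp GrpAlg'_cat (GrpAlg' G) (GrpAlg' H) (GrpAlg' K)
    (lin_ext F g) (lin_ext F f).
Proof.
apply: graded_hom_eq_basis => x.
rewrite [LHS]lin_ext_basis -[RHS]/(lin_ext_fun g (lin_ext_fun f (gbasis x))).
by rewrite !lin_ext_basis.
Qed.

Definition galg_functor : functor Grp'_cat GrpAlg'_cat :=
  @Functor Grp'_cat GrpAlg'_cat GrpAlg' (fun G H f => lin_ext F f)
    galg_fmap1 galg_fmapM.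

End Categories.

(* Main.v *)
Require Import Defs.
From HB Require Import structures.
From mathcomp Require Import all_boot all_algebra.
From mathcomp Require Import boolp.
From mathcomp.multinomials Require Import monalg.

(** A graded homomorphism [phi] from FG to FH sends each basis vector u_g to a
    multiple chi(g) u_f(g), where f is the map of indices given by the functor
    U. Multiplicativity of [phi] and f makes chi multiplicative, and chi never
    vanishes because [phi] is non-zero and every u_g is invertible. So chi is a
    one-dimensional representation of G, and [phi] is determined by the group
    homomorphism f together with this character (lemmas [graded_hom_basis] and
    [graded_coeffM]).

    When all characters of G are trivial, [phi] is therefore the linear
    extension of f ([graded_group_homK]). Conversely, U recovers f from its
    linear extension ([lin_extK]). Thus U is bijective on each set of
    morphisms, with the functor F- as its inverse. Since the two
    functors are also mutually inverse on objects, this yields the equality of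
    functors FU = 1 and UF = 1, and the action of U on morphisms is the natural
    bijection theta. *)

Set Implicit Arguments.
Unset Strict Implicit.
Unset Printing Implicit Defensive.

Import GRing.Theory.
Local Open Scope ring_scope.

(** Asking for literally the same object map avoids transporting morphisms
    along equalities of objects. This is enough for the functors at hand, whose
    object maps agree by conversion. *)
Lemma functor_eq_map (C D : category) (ob : C -> D)
    (m m' : forall a b, cat_hom a b -> cat_hom (ob a) (ob b)) m1 mM m1' mM' :
    (forall a b (f : cat_hom a b), m a b f = m' a b f) ->
  @Functor C D ob m m1 mM = @Functor C D ob m' m1' mM'.
Proof.
move=> E; have {}E : m = m'.
  by do 3![apply: functional_extensionality_dep => ?]; apply: E.
case: m' / E m1' mM' => m1' mM'.
by rewrite (Prop_irrelevance m1 m1') (Prop_irrelevance mM mM').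
Qed.

Section GradedCharacter.
Variables (F : fieldType) (G H : groupType) (phi : graded_hom F G H).

Definition graded_coeff (g : G) : F :=
  mcoeff (graded_idx phi g) (phi (gbasis g)).

Lemma graded_hom_basis g :
  phi (gbasis g) = graded_coeff g *: gbasis (graded_idx phi g).
Proof.
have [a E] := graded_idxP phi (gbasis_component F g).
by rewrite /graded_coeff E mcoeffZ mcoeffUU mulr1.
Qed.

Lemma graded_coeff_unit g : graded_coeff g \is a GRing.unit.
Proof.
rewrite unitfE; apply: contraNneq (graded_hom_basis_neq0 phi g) => c0.
by rewrite graded_hom_basis c0 scale0r.
Qed.

(** Compare the coefficients of the two expressions for [phi] (u_g u_h). *)
Lemma graded_coeffM g h :
  graded_coeff (g * h)%g = graded_coeff g * graded_coeff h.
Proof.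
rewrite {1}/graded_coeff -gbasisM graded_homM !graded_hom_basis gbasisMZ.
by rewrite graded_idxM mcoeffZ mcoeffUU mulr1.
Qed.

Lemma graded_coeff1 : graded_coeff 1%g = 1.
Proof.
apply: (mulrI (graded_coeff_unit 1%g)).
by rewrite -graded_coeffM mulg1 mulr1.
Qed.

Definition graded_char_fun (g : G) : unit_group F :=
  exist _ (graded_coeff g) (graded_coeff_unit g).

Fact graded_char_fun1 : graded_char_fun 1%g = 1%g.
Proof. by apply: val_inj; rewrite /= graded_coeff1. Qed.

Fact graded_char_funM g h :
  graded_char_fun (g * h)%g = (graded_char_fun g * graded_char_fun h)%g.
Proof. by apply: val_inj; rewrite /= graded_coeffM. Qed.

Definition graded_char : group_hom G (unit_group F) :=
  HB.pack graded_char_fun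
    (isUMagmaMorphism.Build G (unit_group F) graded_char_fun
       (graded_char_fun1, graded_char_funM)).

End GradedCharacter.

Lemma lin_extK (F : fieldType) (G H : groupType) (f : group_hom G H) :
  graded_group_hom (lin_ext F f) = f.
Proof.
apply: group_hom_ext => g; apply: graded_idx_uniq => _ [a ->]; exists a.
by rewrite linearZ /= lin_ext_basis.
Qed.

(** This is where the absence of non-trivial characters enters: it forces every
    coefficient of [phi] on the basis to be 1, so that [phi] and the linear
    extension of its index map agree on the basis. *)
Lemma graded_group_homK (F : fieldType) (G : grp' F) (H : groupType)
    (phi : graded_hom F G H) :
  lin_ext F (graded_group_hom phi) = phi.
Proof.
apply: graded_hom_eq_basis => g.
rewrite [LHS]lin_ext_basis graded_hom_basis.
have /(congr1 val) /= -> := grp_no_char (graded_char phi) g.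
by rewrite scale1r.
Qed.

Theorem proposition8p1 (F : fieldType) :
  (exists theta : forall (G : Grp'_cat F) (A : GrpAlg'_cat F),
      cat_hom (galg_functor F G) A -> cat_hom G (U_functor F A),
    [/\ forall (G : Grp'_cat F) (A : GrpAlg'_cat F), bijective (theta G A),
        forall (G : Grp'_cat F) (A B : GrpAlg'_cat F)
          (psi : cat_hom A B) (phi : cat_hom (galg_functor F G) A),
          theta G B (cat_comp psi phi) =
          cat_comp (functor_map (U_functor F) psi) (theta G A phi)
      & forall (G H : Grp'_cat F) (A : GrpAlg'_cat F)
          (f : cat_hom G H) (phi : cat_hom (galg_functor F H) A),
          theta G A (cat_comp phi (functor_map (galg_functor F) f)) =
          cat_comp (theta H A phi) f]) /\
  [/\ comp_functor (galg_functor F) (U_functor F) = id_functor (GrpAlg'_cat F),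
      comp_functor (U_functor F) (galg_functor F) = id_functor (Grp'_cat F)
    & isomorphic_categories (Grp'_cat F) (GrpAlg'_cat F)].
Proof.
have FU1 :
  comp_functor (galg_functor F) (U_functor F) = id_functor (GrpAlg'_cat F).
  by apply: functor_eq_map => A B phi; exact: graded_group_homK.
have UF1 :
  comp_functor (U_functor F) (galg_functor F) = id_functor (Grp'_cat F).
  by apply: functor_eq_map => G H f; exact: lin_extK.
split; last by split=> //; exists (galg_functor F), (U_functor F).
exists (fun G A phi => functor_map (U_functor F) phi); split.
- move=> G A; exists (fun f : group_hom G (base_grp A) => lin_ext F f).
  + by move=> phi; exact: graded_group_homK.
  + by move=> f; exact: lin_extK.
- move=> G A B psi phi.
  (* The two sides have the same type because U(FG) is G by conversion. *)
  exact (functor_mapM (U_functor F) psi phi).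
- move=> G H A f phi; rewrite (functor_mapM (U_functor F)).
  by congr cat_comp; exact: lin_extK.
Qed.
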